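(* For every positive integer $n$ there exists a tree $T$ such that $\beta(T^{3})=n$.
   Context: All graphs are finite, simple, undirected and connected; $d_G$ denotes shortest-path distance. A set $S\subseteq V(G)$ is a resolving set of $G$ if for all distinct $u,v\in V(G)$ there is $s\in S$ with $d_G(s,u)\ne d_G(s,v)$; the metric dimension $\beta(G)$ is the minimum cardinality of a resolving set. For a tree $T$, $T^3$ is the graph on $V(T)$ in which distinct $u,v$ are adjacent iff $d_T(u,v)\le 3$. *)

(* Defs.v *)
From mathcomp Require Import all_boot.

Set Implicit Arguments.
Unset Strict Implicit.
Unset Printing Implicit Defensive.

Record sgraph := SGraph {
  vertex :> finType;
  edge : rel vertex;
  edge_sym : symmetric edge;
  edge_irr : irreflexive edge
}.

Definition connected (G : sgraph) : Prop :=
  0 < #|G| /\ forall u v : G, connect (@edge G) u v.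

(* A graph cycle is a duplicate-free cyclic sequence of at least 3 vertices;
   an edge traversed back and forth is a ucycle of size 2. *)
Definition acyclic (G : sgraph) : Prop :=
  forall c : seq G, ucycle (@edge G) c -> size c < 3.

Definition is_tree (G : sgraph) : Prop := connected G /\ acyclic G.

Definition walk (G : sgraph) (k : nat) (u v : G) : bool :=
  [exists p : k.-tuple G, path (@edge G) u p && (last u p == v)].

(* Length of a shortest walk. In a connected graph it is less than #|G|; the
   value is #|G| (junk) when u and v lie in different components. *)
Definition dist (G : sgraph) (u v : G) : nat :=
  find (fun k => walk k u v) (iota 0 #|G|).

Lemma walkP (G : sgraph) k (u v : G) :
  reflect (exists p, [/\ size p = k, path (@edge G) u p & last u p = v])
          (walk k u v).
Proof.
apply: (iffP existsP) => [[p /andP[pp /eqP lp]]|[p [sp pp lp]]].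
  by exists p; rewrite size_tuple.
by move/eqP: sp => sp; exists (Tuple sp); rewrite /= pp lp eqxx.
Qed.

Lemma walk_sym (G : sgraph) k (u v : G) : walk k u v = walk k v u.
Proof.
have W (x y : G) : walk k x y -> walk k y x.
  case/walkP=> p [sp pp lp]; apply/walkP; exists (rev (belast x p)).
  split; first by rewrite size_rev size_belast.
    by rewrite -lp rev_path (eq_path (e' := @edge G)) // => a b; rewrite edge_sym.
  by case: p {sp pp} lp => [|a p] //= _; rewrite rev_cons last_rcons.
by apply/idP/idP; apply: W.
Qed.

Lemma dist_sym (G : sgraph) (u v : G) : dist u v = dist v u.
Proof. by apply: eq_find => k; rewrite walk_sym. Qed.

Lemma dist_eq0 (G : sgraph) (u v : G) : (dist u v == 0) = (u == v).
Proof.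
rewrite /dist; have: 0 < #|G| by apply/card_gt0P; exists u.
case: #|G| => // n _ /=.
have -> : walk 0 u v = (u == v).
  apply/walkP/eqP => [[p [/size0nil -> _ //]]|->].
  by exists [::].
by case: (u == v).
Qed.

Lemma dist_shortest (G : sgraph) (u v : G) : connect (@edge G) u v ->
  walk (dist u v) u v /\ forall k, walk k u v -> dist u v <= k.
Proof.
case/connectP=> p0 pp0 lp0.
have W : has (fun k => walk k u v) (iota 0 #|G|).
  case/shortenP: pp0 lp0 => p pp up _ lp; apply/hasP; exists (size p).
    rewrite mem_iota /= add0n; have /= <- := card_uniqP up.
    exact: max_card.
  by apply/walkP; exists p.
have lt : dist u v < #|G| by rewrite -[X in _ < X](size_iota 0) -has_find.
split; first by have := nth_find 0 W; rewrite nth_iota.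
move=> k wk; rewrite leqNgt; apply/negP => kd.
by have := before_find 0 kd; rewrite nth_iota ?(ltn_trans kd lt) // add0n wk.
Qed.

Definition resolving (G : sgraph) (S : {set G}) : bool :=
  [forall u, forall v, (u != v) ==> [exists s in S, dist s u != dist s v]].

Lemma resolving_setT (G : sgraph) : resolving [set: G].
Proof.
apply/forallP => u; apply/forallP => v; apply/implyP => uv.
apply/existsP; exists u; rewrite inE /=.
have /eqP -> : dist u u == 0 by rewrite dist_eq0.
by rewrite eq_sym dist_eq0.
Qed.

Definition metric_dim (G : sgraph) : nat :=
  #|[arg min_(S < [set: G] | resolving S) #|S|]|.

Lemma metric_dim_min (G : sgraph) :
  (exists2 S : {set G}, resolving S & #|S| = metric_dim G) /\
  forall S : {set G}, resolving S -> metric_dim G <= #|S|.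
Proof.
rewrite /metric_dim; case: arg_minnP => [|S rS minS].
  exact: resolving_setT.
by split; first by exists S.
Qed.

Section Power.
Variables (G : sgraph) (k : nat).

Definition power_rel : rel G := [rel u v | (u != v) && (dist u v <= k)].

Lemma power_sym : symmetric power_rel.
Proof. by move=> u v; rewrite /power_rel /= eq_sym dist_sym. Qed.

Lemma power_irr : irreflexive power_rel.
Proof. by move=> u; rewrite /power_rel /= eqxx. Qed.

Definition graph_power : sgraph := SGraph power_sym power_irr.
End Power.

(* Main.v *)
Require Import Defs.
From mathcomp Require Import all_boot.

Set Implicit Arguments.
Unset Strict Implicit.
Unset Printing Implicit Defensive.

(** The cube of the star with [n] leaves is the complete graph on [n + 1]
    vertices. All distances between distinct vertices of a complete graph are 1,
    so a set is resolving iff it misses at most one vertex. *)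

(** The walk itself witnesses that [u] and [v] are connected, so the default value of [dist] cannot
    occur. *)
Lemma dist_le_walk (G : sgraph) (u v : G) k : walk k u v -> dist u v <= k.
Proof.
move=> w; have [p [_ pp lp]] := walkP _ _ _ w.
have uv : connect (@edge G) u v by apply/connectP; exists p.
by case: (dist_shortest uv) => _; apply.
Qed.

Definition complete (G : sgraph) : Prop :=
  forall u v : G, edge u v = (u != v).

Lemma dist_complete (G : sgraph) (u v : G) : complete G -> dist u v = (u != v).
Proof.
move=> cG; case: eqVneq => [->|uv]; first by apply/eqP; rewrite dist_eq0.
apply/eqP; rewrite eqn_leq lt0n dist_eq0 uv andbT.
by apply/dist_le_walk/walkP; exists [:: v]; rewrite /= cG uv.
Qed.

(** In a complete graph a vertex separates only itself from the others, so a pair is left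
    unseparated exactly when both of its members lie outside [S]. *)
Lemma resolving_complete (G : sgraph) (S : {set G}) : complete G ->
  resolving S = (#|~: S| <= 1).
Proof.
move=> cG; apply/idP/card_le1_eqP => [rS u v|S1].
  rewrite !inE => uS vS; apply/eqP/negPn/negP => uv.
  have /forallP/(_ u)/forallP/(_ v) := rS; rewrite eq_sym uv /=.
  case/existsP=> s /andP[sS]; rewrite !dist_complete //.
  by rewrite (memPn uS s sS) (memPn vS s sS).
apply/forallP => u; apply/forallP => v; apply/implyP => uv; apply/existsP.
have [uS|uS] := boolP (u \in S).
  by exists u; rewrite uS !dist_complete // eqxx uv.
have [vS|vS] := boolP (v \in S).
  by exists v; rewrite vS !dist_complete // eqxx (eq_sym v) uv.
by move: uv; rewrite (S1 u v) ?inE // eqxx.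
Qed.

Lemma metric_dim_complete (G : sgraph) : complete G -> metric_dim G = #|G|.-1.
Proof.
move=> cG; have [[S rS <-] minS] := metric_dim_min G.
have S_ge : #|G|.-1 <= #|S|.
  rewrite resolving_complete // in rS.
  by rewrite -(cardsC S) -subn1 leq_subLR addnC leq_add2r.
apply/eqP; rewrite eqn_leq S_ge andbT.
(* All vertices but one form a resolving set that attains the bound; in the empty graph both sides
   are 0. *)
have [x _|G0] := pickP G; last first.
  by rewrite (leq_trans (max_card _)) // (eq_card0 G0).
by rewrite -(cardsC1 x) minS // resolving_complete // setCK cards1.
Qed.

(** [None] is the centre and each [Some i] is a leaf. *)
Definition star_rel n : rel (option 'I_n) :=
  [rel u v | (u != v) && ((u == None) || (v == None))].

Lemma star_sym n : symmetric (@star_rel n).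
Proof. by move=> u v; rewrite /star_rel /= eq_sym orbC. Qed.

Lemma star_irr n : irreflexive (@star_rel n).
Proof. by move=> u; rewrite /star_rel /= eqxx. Qed.

Definition star n : sgraph := SGraph (@star_sym n) (@star_irr n).

Lemma star_edgeE n (u v : option 'I_n) :
  @edge (star n) u v = (u != v) && ((u == None) || (v == None)).
Proof. by []. Qed.

(** Two leaves are joined through the centre. This gives both the connectedness of the star and the
    completeness of its cube. *)
Lemma walk2_star n (u v : option 'I_n) : u != v ->
  exists2 k, k <= 2 & @walk (star n) k u v.
Proof.
move=> uv; have [uN|] := boolP ((u == None) || (v == None)).
  by exists 1 => //; apply/walkP; exists [:: v]; rewrite /path star_edgeE uv uN.
rewrite negb_or => /andP[uN vN].
exists 2 => //; apply/walkP; exists [:: None; v].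
by rewrite /path !star_edgeE uN (eq_sym None v) vN orbT.
Qed.

Lemma star_tree n : is_tree (star n).
Proof.
split; first split; first by apply/card_gt0P; exists None.
  move=> u v; have [->|uv] := eqVneq u v; first exact: connect0.
  have [k _ /walkP[p [_ pp lp]]] := walk2_star uv.
  by apply/connectP; exists p.
case=> [|x [|y [|z c]]] // /andP[/and3P[xy yz zx] /and3P[xc yc _]].
(* The last vertex [w] of the cycle closes it by an edge to [x]; in a triangle [w] is [z]. *)
have {zx}: path (@edge (star n)) z (rcons c x) := zx.
rewrite rcons_path => /andP[_]; move: xy yz (mem_last z c) xc yc.
rewrite !star_edgeE; move: (last z c) => w /andP[nxy xy] /andP[_ yz] wc xc yc /andP[_ wx].
have zc : z \in z :: c := mem_head z c.
move: xc; rewrite inE negb_or => /andP[_ xc].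
(* The edge [xy] contains the centre. If [x] is the centre, the edge [yz] misses it; if [y] is, the
   edge [wx] misses it. Either way an edge would join two leaves. *)
move: (memPn xc _ zc) (memPn yc _ zc) (memPn yc _ wc).
by clear xc yc zc wc; case: x y z w nxy xy yz wx => [x|] [y|] [z|] [w|].
Qed.

Lemma complete_star_cube n : complete (graph_power (star n) 3).
Proof.
move=> u v; rewrite /edge /= /power_rel /=; case: eqVneq => //= uv.
have [k k2 kw] := walk2_star uv.
by rewrite (leq_trans (dist_le_walk kw)) // (leq_trans k2).
Qed.

Theorem lemma6p2 (n : nat) (hn : 0 < n) :
  exists T : sgraph, is_tree T /\ metric_dim (graph_power T 3) = n.
Proof.
exists (star n); split; first exact: star_tree.
rewrite metric_dim_complete; last exact: complete_star_cube.
by rewrite card_option card_ord.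
Qed.
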